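(* Let ${\cal O}\subseteq{\it HML}$ and suppose that $\sim_{\cal O}$ is compositional with respect to all projection operators, i.e. for every labelled transition system, all states $x,y$ of its projection closure and all $n\in\mathbb{N}$, $x\sim_{\cal O}y$ implies $\pi_n(x)\sim_{\cal O}\pi_n(y)$. Then the Approximation Induction Principle is sound for $\sim_{\cal O}$ (i.e. for every labelled transition system and all states $x,y$ of its projection closure, if $\pi_n(x)\sim_{\cal O}\pi_n(y)$ for all $n\in\mathbb{N}$ then $x\sim_{\cal O}y$) if and only if there exists ${\cal O}_1\subseteq{\it HML}_{\it FDP}$ such that $\sim_{\cal O}$ and $\sim_{{\cal O}_1}$ coincide (on all states of projection closures of all labelled transition systems).
   Context: A labelled transition system consists of a set $S$ of states, a set $A$ of actions and transitions $s\xrightarrow{a}s'$. For each $n\in\mathbb{N}$ there is a projection operator $\pi_n$; the projection closure has as states all expressions obtained from states of $S$ by finitely many applications of the $\pi_n$, with the original transitions together with those given by the rule: if $x\xrightarrow{a}x'$ then $\pi_{n+1}(x)\xrightarrow{a}\pi_n(x')$ (these are the only transitions of projected states). Hennessy-Milner logic ${\it HML}$ has formulas $\varphi ::= {\sf T} \mid \bigwedge_{i\in I}\varphi_i \mid \langle a\rangle\varphi \mid \neg\varphi$ ($a\in A$, $I$ arbitrary index set) with the usual satisfaction relation ($s\models\langle a\rangle\varphi$ iff some $a$-successor of $s$ satisfies $\varphi$; conjunction and negation classical). The depth is $d({\sf T})=0$, $d(\bigwedge_{i\in I}\varphi_i)=\sup_i d(\varphi_i)$, $d(\langle a\rangle\varphi)=1+d(\varphi)$,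 $d(\neg\varphi)=d(\varphi)$; ${\it HML}_{\it FDP}$ is the set of formulas of finite depth. For ${\cal O}\subseteq{\it HML}$, $x\sim_{\cal O}y$ means $x$ and $y$ satisfy exactly the same formulas of ${\cal O}$. *)

(* Defs.v *)
From Stdlib Require Import Arith Lia Ensembles Classical ClassicalEpsilon.

Set Implicit Arguments.
Unset Strict Implicit.

Record LTS (A : Type) : Type := mkLTS {
  state : Type;
  trans : state -> A -> state -> Prop
}.

Arguments mkLTS {A} state trans.

Section ProjectionClosure.
Variables (A : Type) (L : LTS A).

Inductive pstate : Type :=
| base (s : state L)
| proj (n : nat) (x : pstate).

Inductive ptrans : pstate -> A -> pstate -> Prop :=
| ptrans_base s a s' : trans s a s' -> ptrans (base s) a (base s')
| ptrans_proj n x a x' :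
    ptrans x a x' -> ptrans (proj (S n) x) a (proj n x').

Definition proj_closure : LTS A := mkLTS pstate ptrans.

End ProjectionClosure.

Inductive HML (A : Type) : Type :=
| Top : HML A
| Conj (I : Type) (phi : I -> HML A) : HML A
| Dia (a : A) (phi : HML A) : HML A
| Neg (phi : HML A) : HML A.

Arguments Top {A}.
Arguments Conj {A} I phi.

Fixpoint sat (A : Type) (L : LTS A) (s : state L) (phi : HML A) : Prop :=
  match phi with
  | Top => True
  | Conj _ phis => forall i, sat s (phis i)
  | Dia a psi => exists s', trans s a s' /\ sat s' psi
  | Neg psi => ~ sat s psi
  end.

(* Depths are ordinals at most omega: suprema of families of such ordinals
   are again at most omega, and so is [1 + d], since 1 + omega = omega. *)
Inductive dval : Set :=
| Fin (n : nat)
| Omega.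

Definition dle (d e : dval) : Prop :=
  match d, e with
  | _, Omega => True
  | Fin m, Fin n => m <= n
  | Omega, Fin _ => False
  end.

Definition one_plus (d : dval) : dval :=
  match d with
  | Fin n => Fin (1 + n)
  | Omega => Omega
  end.

Definition is_dsup (I : Type) (f : I -> dval) (d : dval) : Prop :=
  (forall i, dle (f i) d) /\ (forall e, (forall i, dle (f i) e) -> dle d e).

Definition dsup (I : Type) (f : I -> dval) : dval :=
  epsilon (inhabits Omega) (is_dsup f).

Lemma dsup_spec (I : Type) (f : I -> dval) : is_dsup f (dsup f).
Proof.
unfold dsup; apply epsilon_spec.
destruct (classic (exists n, forall i, dle (f i) (Fin n))) as [[n Hn] | H].
- revert Hn; induction n as [n IH] using lt_wf_ind; intros Hn.
  destruct (classic (exists m, m < n /\ forall i, dle (f i) (Fin m)))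
    as [[m [Hmn Hm]] | Hmin]; [now apply (IH m) |].
  exists (Fin n); split; [exact Hn |].
  intros [m |] Hm; [| exact Logic.I].
  simpl; destruct (le_lt_dec n m) as [Hle | Hlt]; [exact Hle |].
  exfalso; apply Hmin; now exists m.
- exists Omega; split.
  + intros i; now destruct (f i).
  + intros [m |] Hm; [exfalso; apply H; now exists m | exact Logic.I].
Qed.

Fixpoint depth (A : Type) (phi : HML A) : dval :=
  match phi with
  | Top => Fin 0
  | Conj _ phis => dsup (fun i => depth (phis i))
  | Dia _ psi => one_plus (depth psi)
  | Neg psi => depth psi
  end.

Definition HML_FDP (A : Type) : Ensemble (HML A) :=
  fun phi => exists n, depth phi = Fin n.

Definition equiv_on (A : Type) (O : Ensemble (HML A)) (L : LTS A)
    (x y : state L) : Prop :=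
  forall phi, In _ O phi -> (sat x phi <-> sat y phi).

Definition proj_compositional (A : Type) (O : Ensemble (HML A)) : Prop :=
  forall (L : LTS A) (x y : state (proj_closure L)) (n : nat),
    equiv_on O x y ->
    equiv_on O (L := proj_closure L) (proj n x) (proj n y).

Definition AIP_sound (A : Type) (O : Ensemble (HML A)) : Prop :=
  forall (L : LTS A) (x y : state (proj_closure L)),
    (forall n, equiv_on O (L := proj_closure L) (proj n x) (proj n y)) ->
    equiv_on O x y.

Definition equiv_coincide (A : Type) (O O1 : Ensemble (HML A)) : Prop :=
  forall (L : LTS A) (x y : state (proj_closure L)),
    equiv_on O x y <-> equiv_on O1 x y.

(* Main.v *)
(** [pi_n x] satisfies [phi] iff [x] satisfies the truncation of [phi] that
    replaces every diamond nested more than [n] deep by falsity; this truncation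
    has depth at most [n], and formulas of depth at most [n] do not distinguish
    [x] from [pi_n x]. Compositionality and AIP together say that [x ~ y] iff
    [pi_n x ~ pi_n y] for all [n], so the truncations of the formulas in [O]
    characterise [~_O]. *)

Require Import Defs.
From Stdlib Require Import Ensembles Arith.

Set Implicit Arguments.
Unset Strict Implicit.

(** The value at [n = 0] mirrors the fact that [proj 0 x] has no transitions, so that no diamond
    holds there. *)
Fixpoint trunc (A : Type) (n : nat) (phi : HML A) : HML A :=
  match phi with
  | Top => Top
  | Conj J phis => Conj J (fun i => trunc n (phis i))
  | Dia a psi =>
      match n with
      | 0 => Neg Top
      | S m => Dia a (trunc m psi)
      end
  | Neg psi => Neg (trunc n psi)
  end.

(** The same [n] bounds every conjunct, hence also the supremum over an infinite conjunction. *)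
Lemma depth_trunc (A : Type) (phi : HML A) (n : nat) :
  dle (depth (trunc n phi)) (Fin n).
Proof.
revert n; induction phi as [| J phis IH | a psi IH | psi IH]; intros n; simpl.
- apply Nat.le_0_l.
- apply (proj2 (dsup_spec _)); intros i; apply IH.
- destruct n as [| m]; simpl; [apply le_n |].
  specialize (IH m); destruct (depth (trunc m psi)); simpl in *.
  + now apply le_n_S.
  + contradiction.
- apply IH.
Qed.

Lemma trunc_FDP (A : Type) (phi : HML A) (n : nat) :
  In _ (@HML_FDP A) (trunc n phi).
Proof.
generalize (depth_trunc phi n); unfold In, HML_FDP.
destruct (depth (trunc n phi)) as [m |]; simpl; [now exists m | contradiction].
Qed.

Lemma dle_trans (d e f : dval) : dle d e -> dle e f -> dle d f.
Proof.
destruct d, e, f; simpl; try tauto; apply Nat.le_trans.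
Qed.

Section Satisfaction.
Variables (A : Type) (L : LTS A).
Let P := proj_closure L.

Lemma sat_proj_Dia (n : nat) (x : state P) (a : A) (psi : HML A) :
  sat (L := P) (proj (S n) x) (Dia a psi) <->
  exists x' : state P, trans x a x' /\ sat (L := P) (proj n x') psi.
Proof.
split.
- intros [z [Hz Hsat]]; simpl in Hz; inversion Hz; subst; eauto.
- intros [x' [Hx Hsat]]; exists (proj n x'); split; [now constructor | exact Hsat].
Qed.

Lemma sat_proj_trunc (phi : HML A) (n : nat) (x : state P) :
  sat (L := P) (proj n x) phi <-> sat x (trunc n phi).
Proof.
revert n x; induction phi as [| J phis IH | a psi IH | psi IH]; intros n x.
- reflexivity.
- split; intros H i; apply IH, H.
- destruct n as [| m].
  + split.
    * intros [z [Hz _]]; simpl in Hz; inversion Hz.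
    * intros H; exfalso; now apply H.
  + rewrite sat_proj_Dia.
    split; intros [x' [Hx Hsat]]; exists x'; split; trivial; now apply IH.
- simpl; now rewrite IH.
Qed.

(** Passing a diamond lowers the depth of the formula and the index of the projection together, so
    the index never runs out first. *)
Lemma sat_proj_depth (phi : HML A) (n : nat) (x : state P) :
  dle (depth phi) (Fin n) -> sat (L := P) (proj n x) phi <-> sat x phi.
Proof.
revert n x; induction phi as [| J phis IH | a psi IH | psi IH];
  intros n x Hd; simpl in Hd.
- reflexivity.
- assert (Hi : forall i, dle (depth (phis i)) (Fin n)).
  { intros i; exact (dle_trans (proj1 (dsup_spec _) i) Hd). }
  split; intros H i; apply (IH i n x (Hi i)), H.
- destruct n as [| m].
  + destruct (depth psi); simpl in Hd; [inversion Hd | contradiction].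
  + assert (Hpsi : dle (depth psi) (Fin m)).
    { destruct (depth psi); [now apply le_S_n | exact Hd]. }
    rewrite sat_proj_Dia.
    split; intros [x' [Hx Hsat]]; exists x'; split; trivial;
      now apply (IH m x' Hpsi).
- simpl; now rewrite (IH n x Hd).
Qed.

End Satisfaction.

Theorem theorem11 (A : Type) (O : Ensemble (HML A))
    (HO : proj_compositional O) :
  AIP_sound O <->
  exists O1 : Ensemble (HML A),
    Included _ O1 (@HML_FDP A) /\ equiv_coincide O O1.
Proof.
split.
- intros Haip.
  exists (fun psi => exists n phi, In _ O phi /\ psi = trunc n phi); split.
  + intros psi [n [phi [_ ->]]]; apply trunc_FDP.
  + intros L x y; split.
    * intros Hxy psi [n [phi [Hphi ->]]].
      (* Truncation is traded for projection, where [HO] applies to [phi] itself. *)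
      rewrite <- !sat_proj_trunc; exact (HO L x y n Hxy phi Hphi).
    * intros Hxy; apply Haip; intros n phi Hphi.
      rewrite !sat_proj_trunc; apply Hxy; now exists n, phi.
- intros [O1 [Hfdp Hco]] L x y Hxy.
  apply Hco; intros phi Hphi.
  destruct (Hfdp phi Hphi) as [n Hn].
  assert (Hd : dle (depth phi) (Fin n)) by (rewrite Hn; apply le_n).
  rewrite <- (sat_proj_depth x Hd), <- (sat_proj_depth y Hd).
  (* [Hco] is used a second time, now at the projected states, to carry [Hxy n] from [O] to [O1];
     the index [n] is the depth of [phi]. *)
  exact (proj1 (Hco L (proj n x) (proj n y)) (Hxy n) phi Hphi).
Qed.
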